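(* Let $H:\mathbb{R}\to\mathbb{R}$ be a continuously differentiable, 1-periodic, positive function. Then the following six identities hold: 1. $\big\langle H^{-5}\,([\![H^{-1}]\!])^2\, H'\big\rangle=\frac12\big\langle H^{-5}\,[\![H^{-1}]\!]\big\rangle-\frac12\langle H^{-1}\rangle\big\langle H^{-4}\,[\![H^{-1}]\!]\big\rangle$; 2. $\big\langle H^{-3}\,([\![H^{-2}]\!])^2\, H'\big\rangle=\big\langle H^{-4}\,[\![H^{-2}]\!]\big\rangle$; 3. $\big\langle H^{-1}\,[\![\,[\![\,H^{-3}\,[\![\,[\![H^{-1}]\!]\,]\!]\,H'\,]\!]\,]\!]\big\rangle=\big\langle H^{-2}\,[\![H^{-1}]\!]\,[\![\,[\![H^{-1}]\!]\,]\!]\big\rangle$; 4. $\big\langle H^{-3}\,[\![H^{-2}]\!]\,[\![\,[\![H^{-1}]\!]\,]\!]\,H'\big\rangle=\frac12\big\langle H^{-2}\,[\![H^{-1}]\!]\,[\![H^{-2}]\!]\big\rangle-\frac12\big\langle[\![H^{-1}]\!]\,[\![H^{-4}]\!]\big\rangle+\frac12\langle H^{-2}\rangle\big\langle[\![H^{-1}]\!]\,[\![H^{-2}]\!]\big\rangle$; 5. $\big\langle H^{-1}\,[\![\,[\![\,H^{-4}\,[\![H^{-1}]\!]\,H'\,]\!]\,]\!]\big\rangle=\frac13\big\langle H^{-3}\,([\![H^{-1}]\!])^2\big\rangle-\frac13\big\langle[\![H^{-1}]\!]\,[\![H^{-4}]\!]\big\rangle+\frac13\langle H^{-1}\rangle\big\langle[\![H^{-1}]\!]\,[\![H^{-3}]\!]\big\rangle$;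 6. $\big\langle H^{-4}\,[\![H^{-2}]\!]\,[\![H^{-1}]\!]\,H'\big\rangle=\frac13\big\langle H^{-4}\,[\![H^{-2}]\!]\big\rangle-\frac13\langle H^{-1}\rangle\big\langle H^{-3}\,[\![H^{-2}]\!]\big\rangle+\frac13\big\langle H^{-5}\,[\![H^{-1}]\!]\big\rangle-\frac13\langle H^{-2}\rangle\big\langle H^{-3}\,[\![H^{-1}]\!]\big\rangle$.
   Context: For a continuous 1-periodic function $g:\mathbb{R}\to\mathbb{R}$ define its average over one period $\langle g\rangle:=\int_0^1 g(y)\,dy$, its fluctuating part $\{g\}(y):=g(y)-\langle g\rangle$, and, for all $y\in\mathbb{R}$, $$[\![g]\!](y):=\int_0^y\{g\}(\xi)\,d\xi-\int_0^1\int_0^\tau\{g\}(\xi)\,d\xi\,d\tau .$$ Powers such as $H^{-k}$ are pointwise, $H^{-k}(y)=H(y)^{-k}$, juxtaposition is the pointwise product of functions, and $H'$ is the derivative of $H$. *)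

(* Defs.v *)
From Stdlib Require Import Reals.
From Coquelicot Require Import Coquelicot.
Open Scope R_scope.

Definition one_periodic (g : R -> R) : Prop := forall y : R, g (y + 1) = g y.

Definition continuously_differentiable (g : R -> R) : Prop :=
  (forall y : R, ex_derive g y) /\ (forall y : R, continuous (Derive g) y).

(* [average g], [fluct g] and [bracket g] are <g>, {g} and [[g]]. They are meant
   for continuous 1-periodic g; when an integral does not exist, RInt takes a
   junk value. *)

Definition average (g : R -> R) : R := RInt g 0 1.

Definition fluct (g : R -> R) : R -> R := fun y => g y - average g.

(* the primitive of {g} with zero average *)
Definition bracket (g : R -> R) : R -> R := fun y =>
  RInt (fun xi => fluct g xi) 0 y
  - RInt (fun tau => RInt (fun xi => fluct g xi) 0 tau) 0 1.

(* negpow H k is H^{-k} *)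
Definition negpow (H : R -> R) (k : nat) : R -> R := fun y => / (H y ^ k).

(* Main.v *)
(** All six identities are instances of one integration by parts: the derivative
    of the 1-periodic function [H^{-k} [[g]] [[h]]] has zero average.  Since
    [[[g]]' = g - <g>], this expresses [k <H^{-k-1} [[g]] [[h]] H'>] through
    averages without [H'].  The remaining rearrangements use that the bracket is
    antisymmetric, [<f [[g]]> = - <[[f]] g>], and has zero average. *)
Require Import Defs.
From Stdlib Require Import Reals Lra.
From Coquelicot Require Import Coquelicot.
Open Scope R_scope.

(** * Averages of continuous 1-periodic functions *)

Definition continuous_periodic (g : R -> R) : Prop :=
  (forall y, continuous g y) /\ one_periodic g.

Lemma continuous_periodic_mult (f g : R -> R) :
  continuous_periodic f -> continuous_periodic g ->
  continuous_periodic (fun y => f y * g y).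
Proof.
intros [cf pf] [cg pg]; split; intro y.
- now apply (continuous_mult f g).
- now rewrite pf, pg.
Qed.

Lemma ex_RInt_continuous_all (g : R -> R) (a b : R) :
  (forall y, continuous g y) -> ex_RInt g a b.
Proof. intro cg; apply (ex_RInt_continuous (V := R_CompleteNormedModule)); auto. Qed.

Lemma average_ext (f g : R -> R) : (forall y, f y = g y) -> average f = average g.
Proof. intro fg; apply RInt_ext; auto. Qed.

Lemma average_plus (f g : R -> R) :
  (forall y, continuous f y) -> (forall y, continuous g y) ->
  average (fun y => f y + g y) = average f + average g.
Proof.
intros cf cg.
apply (RInt_plus (V := R_CompleteNormedModule)); now apply ex_RInt_continuous_all.
Qed.

Lemma average_scal (c : R) (f : R -> R) :
  (forall y, continuous f y) -> average (fun y => c * f y) = c * average f.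
Proof.
intro cf.
apply (RInt_scal (V := R_CompleteNormedModule)); now apply ex_RInt_continuous_all.
Qed.

Lemma average_const (c : R) : average (fun _ => c) = c.
Proof.
unfold average; rewrite RInt_const; unfold scal; simpl; unfold mult; simpl; ring.
Qed.

(** By the fundamental theorem of calculus the average is [F 1 - F 0], which periodicity at 0
    cancels. Both integrations by parts below rest on this. *)
Lemma average_derivative (F f : R -> R) :
  one_periodic F -> (forall y, is_derive F y (f y)) ->
  (forall y, continuous f y) -> average f = 0.
Proof.
intros pF dF cf; unfold average.
rewrite (is_RInt_unique f 0 1 (minus (F 1) (F 0))).
- unfold minus, plus, opp; simpl.
  pose proof (pF 0) as e; rewrite Rplus_0_l in e; rewrite e; ring.
- apply (is_RInt_derive (V := R_CompleteNormedModule)); auto.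
Qed.

(** * Derivative, periodicity and zero average of the bracket *)

Lemma fluct_continuous (g : R -> R) (y : R) :
  continuous g y -> continuous (fluct g) y.
Proof.
intro cg; apply (continuous_minus g (fun _ => average g)); auto.
apply continuous_const.
Qed.

Lemma average_fluct (g : R -> R) :
  (forall y, continuous g y) -> average (fluct g) = 0.
Proof.
intro cg.
rewrite (average_ext (fluct g) (fun y => g y + - average g)) by reflexivity.
rewrite average_plus, average_const; auto; [ring | intro; apply continuous_const].
Qed.

Lemma bracket_is_derive (g : R -> R) (y : R) :
  (forall x, continuous g x) -> is_derive (bracket g) y (fluct g y).
Proof.
intro cg.
replace (fluct g y) with (minus (fluct g y) 0)
  by (unfold minus, plus, opp; simpl; ring).
apply (is_derive_minus (fun y => RInt (fluct g) 0 y)); [|apply @is_derive_const].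
apply (is_derive_RInt (fluct g) _ 0).
- apply filter_forall; intro x; apply (RInt_correct (V := R_CompleteNormedModule)).
  apply ex_RInt_continuous_all; intro; now apply fluct_continuous.
- now apply fluct_continuous.
Qed.

Lemma bracket_continuous (g : R -> R) (y : R) :
  (forall x, continuous g x) -> continuous (bracket g) y.
Proof.
intro cg; apply (ex_derive_continuous (V := R_NormedModule)).
exists (fluct g y); now apply bracket_is_derive.
Qed.

(** Translation by 1 identifies the integral over [0, y] with that over [1, y + 1]; splitting the
    integral over [0, y + 1] at [y] and at 1 then gives the claim. *)
Lemma RInt_one_periodic_shift (g : R -> R) (y : R) :
  continuous_periodic g -> RInt g y (y + 1) = RInt g 0 1.
Proof.
intros [cg pg].
pose proof (RInt_comp_lin g 1 1 0 y) as shift.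
rewrite (RInt_ext _ g) in shift.
2:{ intros x _; unfold scal; simpl; unfold mult; simpl.
    rewrite !Rmult_1_l; apply pg. }
replace (1 * 0 + 1) with 1 in shift by ring.
replace (1 * y + 1) with (y + 1) in shift by ring.
specialize (shift (ex_RInt_continuous_all _ _ _ cg)).
pose proof (RInt_Chasles g 0 y (y + 1) (ex_RInt_continuous_all _ _ _ cg)
  (ex_RInt_continuous_all _ _ _ cg)) as e1.
pose proof (RInt_Chasles g 0 1 (y + 1) (ex_RInt_continuous_all _ _ _ cg)
  (ex_RInt_continuous_all _ _ _ cg)) as e2.
unfold plus in e1, e2; simpl in e1, e2; lra.
Qed.

Lemma fluct_continuous_periodic (g : R -> R) :
  continuous_periodic g -> continuous_periodic (fluct g).
Proof.
intros [cg pg]; split; intro y.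
- now apply fluct_continuous.
- unfold fluct; now rewrite pg.
Qed.

(** The increment of [bracket g] over one period is the integral of [fluct g] over a period, which
    is zero. Hence brackets can be nested. *)
Lemma bracket_continuous_periodic (g : R -> R) :
  continuous_periodic g -> continuous_periodic (bracket g).
Proof.
intros cpg; split; intro y; [apply bracket_continuous, cpg|].
pose proof (fluct_continuous_periodic g cpg) as cpf.
pose proof (RInt_Chasles (fluct g) 0 y (y + 1)
  (ex_RInt_continuous_all _ _ _ (proj1 cpf))
  (ex_RInt_continuous_all _ _ _ (proj1 cpf))) as e.
rewrite RInt_one_periodic_shift in e by exact cpf.
pose proof (average_fluct g (proj1 cpg)) as z; unfold average in z.
rewrite z in e; unfold plus in e; simpl in e.
unfold bracket; change (fun xi => fluct g xi) with (fluct g).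
lra.
Qed.

Lemma average_bracket (g : R -> R) :
  (forall y, continuous g y) -> average (bracket g) = 0.
Proof.
intro cg.
set (c := RInt (fun tau => RInt (fun xi => fluct g xi) 0 tau) 0 1).
(* The primitive is [bracket g] plus the constant [c], so it inherits continuity from the
   bracket. *)
assert (cI : forall y, continuous (fun tau => RInt (fun xi => fluct g xi) 0 tau) y).
{ intro y.
  apply (continuous_ext (fun tau => bracket g tau + c)).
  { intro x; change (bracket g x + c = RInt (fluct g) 0 x).
    unfold bracket, c; change (fun xi => fluct g xi) with (fluct g); ring. }
  apply (continuous_plus (bracket g) (fun _ => c)).
  - now apply bracket_continuous.
  - apply continuous_const. }
change (average (bracket g)) with
  (average (fun y => (fun tau => RInt (fun xi => fluct g xi) 0 tau) y + - c)).
rewrite average_plus, average_const; auto.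
- unfold average at 1; unfold c; ring.
- intro; apply continuous_const.
Qed.

(** * Antisymmetry of the bracket under the average *)

Lemma average_mult_fluct (f g : R -> R) :
  continuous_periodic f -> continuous_periodic g ->
  average (fun y => f y * fluct g y)
  = average (fun y => f y * g y) - average g * average f.
Proof.
intros cpf cpg.
rewrite (average_ext _ (fun y => f y * g y + - average g * f y))
  by (intro; unfold fluct; ring).
rewrite average_plus, average_scal.
- ring.
- apply cpf.
- now apply continuous_periodic_mult.
- intro y; apply (continuous_mult (fun _ => - average g) f).
  + apply continuous_const.
  + apply cpf.
Qed.

(** The derivative of [bracket f * bracket g] has zero average. Replacing each [fluct] by the
    function minus its average costs only terms with a factor [average (bracket _)], and these
    vanish. *)
Lemma average_bracket_antisym (f g : R -> R) :
  continuous_periodic f -> continuous_periodic g ->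
  average (fun y => f y * bracket g y) = - average (fun y => bracket f y * g y).
Proof.
intros cpf cpg.
pose proof (bracket_continuous_periodic f cpf) as cpF.
pose proof (bracket_continuous_periodic g cpg) as cpG.
pose proof (fluct_continuous_periodic f cpf) as cpf'.
pose proof (fluct_continuous_periodic g cpg) as cpg'.
assert (z : average (fun y => bracket g y * fluct f y + bracket f y * fluct g y) = 0).
{ apply (average_derivative (fun y => bracket f y * bracket g y)).
  - now apply continuous_periodic_mult.
  - intro y.
    replace (bracket g y * fluct f y + bracket f y * fluct g y)
      with (fluct f y * bracket g y + bracket f y * fluct g y) by ring.
    apply (is_derive_mult (bracket f) (bracket g)).
    + apply bracket_is_derive, cpf.
    + apply bracket_is_derive, cpg.
    + intros; apply Rmult_comm.
  - intro y; apply (continuous_plus (fun y => bracket g y * fluct f y)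
      (fun y => bracket f y * fluct g y)); now apply continuous_periodic_mult. }
rewrite average_plus in z by now apply continuous_periodic_mult.
rewrite !average_mult_fluct in z by assumption.
rewrite !average_bracket in z by (apply cpf || apply cpg).
rewrite (average_ext _ (fun y => bracket g y * f y)) by (intro; ring).
lra.
Qed.

Lemma average_mult_bracket_self (g : R -> R) :
  continuous_periodic g -> average (fun y => g y * bracket g y) = 0.
Proof.
intro cpg.
pose proof (average_bracket_antisym g g cpg cpg) as e.
rewrite (average_ext (fun y => bracket g y * g y) (fun y => g y * bracket g y)) in e
  by (intro; ring).
lra.
Qed.

(** Antisymmetry is applied twice and the signs cancel. This frees a factor containing [Derive H]
    from a double bracket. *)
Lemma average_mult_bracket_bracket (f g : R -> R) :
  continuous_periodic f -> continuous_periodic g ->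
  average (fun y => f y * bracket (bracket g) y)
  = average (fun y => bracket (bracket f) y * g y).
Proof.
intros cpf cpg.
rewrite average_bracket_antisym, average_bracket_antisym;
  auto using bracket_continuous_periodic.
ring.
Qed.

(** * Negative powers of [H] and the integration by parts *)

Lemma negpow_is_derive (H : R -> R) (k : nat) (y : R) :
  ex_derive H y -> 0 < H y ->
  is_derive (negpow H k) y (- INR k * (negpow H (S k) y * Derive H y)).
Proof.
intros dH posH; unfold negpow.
auto_derive.
- repeat split; auto.
  apply pow_nonzero; lra.
- change (fun x => H x) with H.
  (* The power rule produces the exponent [pred k], which is truncated at [k = 0]; that case is
     settled separately. *)
  destruct k as [|k]; [simpl; field; lra|].
  rewrite <- !tech_pow_Rmult; simpl pred.
  field; split; [apply pow_nonzero|]; lra.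
Qed.

Lemma negpow_continuous_periodic (H : R -> R) (k : nat) :
  (forall y, ex_derive H y) -> one_periodic H -> (forall y, 0 < H y) ->
  continuous_periodic (negpow H k).
Proof.
intros dH pH posH; split; intro y.
- apply (ex_derive_continuous (V := R_NormedModule)).
  eexists; now apply negpow_is_derive.
- unfold negpow; now rewrite pH.
Qed.

Lemma Derive_one_periodic (H : R -> R) : one_periodic H -> one_periodic (Derive H).
Proof.
intros pH y; unfold Derive; f_equal; apply Lim_ext; intro h.
replace (y + 1 + h) with (y + h + 1) by ring; now rewrite !pH.
Qed.

(** Since [g] and [h] are arbitrary, either may itself be a bracket; its average then vanishes and
    the corresponding correction term disappears. *)
Lemma average_negpow_bracket_bracket (H g h : R -> R) (k : nat) :
  continuously_differentiable H -> one_periodic H -> (forall y, 0 < H y) ->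
  continuous_periodic g -> continuous_periodic h ->
  INR k * average (fun y => negpow H (S k) y * bracket g y * bracket h y * Derive H y)
  = average (fun y => negpow H k y * bracket h y * g y)
    - average g * average (fun y => negpow H k y * bracket h y)
    + (average (fun y => negpow H k y * bracket g y * h y)
       - average h * average (fun y => negpow H k y * bracket g y)).
Proof.
intros [dH cH'] pH posH cpg cph.
assert (cpN : forall j, continuous_periodic (negpow H j))
  by (intro; now apply negpow_continuous_periodic).
pose proof (conj cH' (Derive_one_periodic H pH) : continuous_periodic (Derive H)) as cpH'.
pose proof (bracket_continuous_periodic g cpg) as cpG.
pose proof (bracket_continuous_periodic h cph) as cpK.
pose proof (fluct_continuous_periodic g cpg) as cpg'.
pose proof (fluct_continuous_periodic h cph) as cph'.
(* Up to the factor [- INR k] on [A], these are the three terms of the product rule for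
   [negpow H k * bracket g * bracket h]. *)
set (A := fun y => negpow H (S k) y * bracket g y * bracket h y * Derive H y).
set (B := fun y => negpow H k y * bracket h y * fluct g y).
set (C := fun y => negpow H k y * bracket g y * fluct h y).
assert (cA : continuous_periodic A) by (unfold A; auto 6 using continuous_periodic_mult).
assert (cB : continuous_periodic B) by (unfold B; auto 6 using continuous_periodic_mult).
assert (cC : continuous_periodic C) by (unfold C; auto 6 using continuous_periodic_mult).
assert (ckA : forall y, continuous (fun y => - INR k * A y) y).
{ intro y; apply (continuous_mult (fun _ => - INR k) A); [|apply cA].
  apply continuous_const. }
assert (cBC : forall y, continuous (fun y => B y + C y) y).
{ intro y; apply (continuous_plus B C); [apply cB|apply cC]. }
assert (z : average (fun y => - INR k * A y + (B y + C y)) = 0).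
{ apply (average_derivative (fun y => negpow H k y * bracket g y * bracket h y)).
  - apply (continuous_periodic_mult (fun y => negpow H k y * bracket g y));
      auto using continuous_periodic_mult.
  - intro y; unfold A, B, C.
    (* This grouping is the one that two nested uses of the product rule produce. *)
    replace (_ + _) with
      ((- INR k * (negpow H (S k) y * Derive H y) * bracket g y
        + negpow H k y * fluct g y) * bracket h y
       + negpow H k y * bracket g y * fluct h y) by ring.
    apply (is_derive_mult (fun y => negpow H k y * bracket g y) (bracket h));
      [|apply bracket_is_derive, cph|intros; apply Rmult_comm].
    apply (is_derive_mult (negpow H k) (bracket g));
      [now apply negpow_is_derive|apply bracket_is_derive, cpg|
       intros; apply Rmult_comm].
  - intro y; now apply (continuous_plus (fun y => - INR k * A y) (fun y => B y + C y)). }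
rewrite average_plus, average_scal, average_plus in z;
  try apply cA; try apply cB; try apply cC; auto.
unfold B, C in z.
rewrite !average_mult_fluct in z; auto using continuous_periodic_mult.
lra.
Qed.

Lemma negpow_mult (H : R -> R) (j k : nat) (y : R) :
  negpow H j y * negpow H k y = negpow H (j + k) y.
Proof. unfold negpow; rewrite pow_add, Rinv_mult; reflexivity. Qed.

Theorem proposition7 :
  forall H : R -> R,
    continuously_differentiable H ->
    one_periodic H ->
    (forall y : R, 0 < H y) ->
    (average (fun y => negpow H 5 y * (bracket (negpow H 1) y) ^ 2 * Derive H y)
     = 1 / 2 * average (fun y => negpow H 5 y * bracket (negpow H 1) y)
       - 1 / 2 * average (negpow H 1)
         * average (fun y => negpow H 4 y * bracket (negpow H 1) y))
    /\
    (average (fun y => negpow H 3 y * (bracket (negpow H 2) y) ^ 2 * Derive H y)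
     = average (fun y => negpow H 4 y * bracket (negpow H 2) y))
    /\
    (average (fun y => negpow H 1 y *
        bracket (bracket (fun z =>
          negpow H 3 z * bracket (bracket (negpow H 1)) z * Derive H z)) y)
     = average (fun y => negpow H 2 y * bracket (negpow H 1) y
                         * bracket (bracket (negpow H 1)) y))
    /\
    (average (fun y => negpow H 3 y * bracket (negpow H 2) y
                       * bracket (bracket (negpow H 1)) y * Derive H y)
     = 1 / 2 * average (fun y => negpow H 2 y * bracket (negpow H 1) y
                                 * bracket (negpow H 2) y)
       - 1 / 2 * average (fun y => bracket (negpow H 1) y * bracket (negpow H 4) y)
       + 1 / 2 * average (negpow H 2)
         * average (fun y => bracket (negpow H 1) y * bracket (negpow H 2) y))
    /\
    (average (fun y => negpow H 1 y *
        bracket (bracket (fun z =>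
          negpow H 4 z * bracket (negpow H 1) z * Derive H z)) y)
     = 1 / 3 * average (fun y => negpow H 3 y * (bracket (negpow H 1) y) ^ 2)
       - 1 / 3 * average (fun y => bracket (negpow H 1) y * bracket (negpow H 4) y)
       + 1 / 3 * average (negpow H 1)
         * average (fun y => bracket (negpow H 1) y * bracket (negpow H 3) y))
    /\
    (average (fun y => negpow H 4 y * bracket (negpow H 2) y
                       * bracket (negpow H 1) y * Derive H y)
     = 1 / 3 * average (fun y => negpow H 4 y * bracket (negpow H 2) y)
       - 1 / 3 * average (negpow H 1)
         * average (fun y => negpow H 3 y * bracket (negpow H 2) y)
       + 1 / 3 * average (fun y => negpow H 5 y * bracket (negpow H 1) y)
       - 1 / 3 * average (negpow H 2)
         * average (fun y => negpow H 3 y * bracket (negpow H 1) y)).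
Proof.
intros H c1H pH posH.
assert (cpN : forall k, continuous_periodic (negpow H k))
  by (intro; apply negpow_continuous_periodic; auto; apply c1H).
assert (cpH' : continuous_periodic (Derive H))
  by (split; [apply c1H|now apply Derive_one_periodic]).
assert (cpB : forall k, continuous_periodic (bracket (negpow H k)))
  by (intro; apply bracket_continuous_periodic, cpN).
assert (cpBB : forall k, continuous_periodic (bracket (bracket (negpow H k))))
  by (intro; apply bracket_continuous_periodic, cpB).
assert (avB : forall k, average (bracket (negpow H k)) = 0)
  by (intro; apply average_bracket, cpN).
(* When [g] or [h] is a negative power, integration by parts leaves it as a last factor; here it is
   merged into the leading power. *)
assert (mulN' : forall j k (f : R -> R),
  average (fun y => negpow H j y * f y * negpow H k y)
  = average (fun y => negpow H (j + k) y * f y)).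
{ intros j k f; apply average_ext; intro y; rewrite <- negpow_mult; ring. }
assert (ibp : forall k g h, continuous_periodic g -> continuous_periodic h -> _)
  by exact (fun k g h => average_negpow_bracket_bracket H g h k c1H pH posH).
assert (antisym : forall k, average (fun y => negpow H k y * bracket (bracket (negpow H 1)) y)
  = - average (fun y => bracket (negpow H 1) y * bracket (negpow H k) y)).
{ intro k; rewrite average_bracket_antisym by auto.
  apply Ropp_eq_compat, average_ext; intro; apply Rmult_comm. }
refine (conj _ (conj _ (conj _ (conj _ (conj _ _))))).
(* With [g = h] the two halves of the right side coincide, so the coefficient is 2/4. *)
- pose proof (ibp 4%nat _ _ (cpN 1%nat) (cpN 1%nat)) as e.
  rewrite !mulN' in e; simpl INR in e; simpl Nat.add in e.
  rewrite (average_ext _ (fun y => negpow H 5 y * bracket (negpow H 1) y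
    * bracket (negpow H 1) y * Derive H y)) by (intro; ring).
  lra.
(* Here the power in front equals [g = h], so the correction term contains the average of a function
   times its own bracket, which is zero. *)
- pose proof (ibp 2%nat _ _ (cpN 2%nat) (cpN 2%nat)) as e.
  rewrite !mulN' in e; simpl INR in e; simpl Nat.add in e.
  rewrite average_mult_bracket_self in e by auto.
  rewrite (average_ext _ (fun y => negpow H 3 y * bracket (negpow H 2) y
    * bracket (negpow H 2) y * Derive H y)) by (intro; ring).
  lra.
(* Moving the double bracket onto [negpow H 1] makes the left side an average with a squared double
   bracket, so [g = h = bracket (negpow H 1)] fits. *)
- rewrite average_mult_bracket_bracket by auto using continuous_periodic_mult.
  pose proof (ibp 2%nat _ _ (cpB 1%nat) (cpB 1%nat)) as e.
  rewrite avB in e; simpl INR in e.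
  rewrite (average_ext _ (fun y => negpow H 3 y * bracket (bracket (negpow H 1)) y
    * bracket (bracket (negpow H 1)) y * Derive H y)) by (intro; ring).
  rewrite (average_ext
    (fun y => negpow H 2 y * bracket (negpow H 1) y * bracket (bracket (negpow H 1)) y)
    (fun y => negpow H 2 y * bracket (bracket (negpow H 1)) y
      * bracket (negpow H 1) y)) by (intro; ring).
  lra.
(* The double bracket on the left forces [h = bracket (negpow H 1)]; [antisym] then removes the
   double brackets remaining on the right. *)
- pose proof (ibp 2%nat _ _ (cpN 2%nat) (cpB 1%nat)) as e.
  rewrite mulN', avB in e; simpl INR in e; simpl Nat.add in e.
  rewrite (antisym 4%nat), (antisym 2%nat) in e.
  rewrite (average_ext
    (fun y => negpow H 2 y * bracket (negpow H 1) y * bracket (negpow H 2) y)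
    (fun y => negpow H 2 y * bracket (negpow H 2) y
      * bracket (negpow H 1) y)) by (intro; ring).
  lra.
(* After the double bracket is moved, the left side carries a double and a single bracket of
   [negpow H 1], which dictates the choice of [g] and [h]. *)
- rewrite average_mult_bracket_bracket by auto using continuous_periodic_mult.
  pose proof (ibp 3%nat _ _ (cpB 1%nat) (cpN 1%nat)) as e.
  rewrite mulN', avB in e; simpl INR in e; simpl Nat.add in e.
  rewrite (antisym 4%nat), (antisym 3%nat) in e.
  rewrite (average_ext (fun y => bracket (bracket (negpow H 1)) y * _)
    (fun y => negpow H 4 y * bracket (bracket (negpow H 1)) y
      * bracket (negpow H 1) y * Derive H y)) by (intro; ring).
  rewrite (average_ext (fun y => negpow H 3 y * bracket (negpow H 1) y ^ 2)
    (fun y => negpow H 3 y * bracket (negpow H 1) y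
      * bracket (negpow H 1) y)) by (intro; ring).
  lra.
- pose proof (ibp 3%nat _ _ (cpN 2%nat) (cpN 1%nat)) as e.
  rewrite !mulN' in e; simpl INR in e; simpl Nat.add in e.
  lra.
Qed.
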